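(* Let $L>0$. For each $\varepsilon>0$ define the gauge function $f_\varepsilon(t)=(\log(1/t))^{-\frac1{2+\varepsilon}}$, $t\in(0,e^{-3}]$. There is a subset $E_\infty\subset(0,L)$ satisfying the following two conclusions: (i) The observability inequality fails for $E_\infty$: for every $T>0$ there is no constant $C_{obs}>0$ such that $$\|u(T,\cdot)\|_{L^2(0,L)}\le C_{obs}\int_0^T\sup_{x\in E_\infty}|u(t,x)|\,dt$$ for all solutions $u$ of $\partial_tu=\partial_x^2u$ ($t>0$, $x\in(0,L)$), $u(t,0)=u(t,L)=0$ ($t\ge 0$), $u(0,\cdot)\in L^2(0,L)$. (ii) $0<c_{f_\varepsilon}(E_\infty)<\infty$, but $c_{h_\alpha}(E_\infty)=0$ for each $\alpha>0$.
   Context: A gauge function is a strictly increasing continuous $f:(0,\infty)\to[0,\infty)$ with $\lim_{t\to0^+}f(t)=0$. For a gauge function $f$, the $f$-Hausdorff content of $E\subset\mathbb R$ is $c_f(E)=\inf\{\sum_{j\ge1} f(d(B_j)):E\subset\bigcup_{j\ge1} B_j\}$, where the $B_j$ are open balls (intervals) with diameter $d(B_j)$. $h_\alpha(t)=(\log\frac1t)^{-1/2}(\log\log\frac1t)^{-\alpha}$ for $0<t\le e^{-3}$. The functions $f_\varepsilon$ and $h_\alpha$ are understood as gauge functions on $(0,\infty)$ via fixed extensions satisfying $f(t)\sim1$ as $t\to+\infty$. The set $E_\infty$ may depend on $\varepsilon$. *)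

(* Defs.v *)
From HB Require Import structures.
From mathcomp Require Export all_boot all_order all_algebra.
From mathcomp Require Export all_classical all_reals all_analysis.
Export Order.TTheory GRing.Theory Num.Theory.
Export numFieldNormedType.Exports.
Set Implicit Arguments.
Unset Strict Implicit.
Unset Printing Implicit Defensive.
Local Open Scope classical_set_scope.
Local Open Scope ring_scope.

(* Gauge functions have domain ]0, +oo[; here they are total functions whose
   values outside ]0, +oo[ are irrelevant. *)
Definition gauge (R : realType) (f : R -> R) : Prop :=
  [/\ forall t : R, 0 < t -> 0 <= f t,
      forall s t : R, 0 < s -> s < t -> f s < f t,
      forall t : R, 0 < t -> {for t, continuous f}
    & f t @[t --> 0^'+] --> (0 : R)].

(* [f] is an admissible extension to ]0, +oo[ of the function [g] given on
   ]0, e^-3]. *)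
Definition gauge_extension (R : realType) (g f : R -> R) : Prop :=
  [/\ gauge f,
      forall t : R, 0 < t -> t <= expR (- 3) -> f t = g t
    & f t @[t --> +oo] --> (1 : R)].

Definition f_eps (R : realType) (eps t : R) : R :=
  ln (1 / t) `^ (- (1 / (2 + eps))).

Definition h_alpha (R : realType) (alpha t : R) : R :=
  ln (1 / t) `^ (- (1 / 2)) * ln (ln (1 / t)) `^ (- alpha).

Definition hausdorff_content (R : realType) (f : R -> R) (E : set R) : \bar R :=
  ereal_inf [set s | exists c r : nat -> R,
    [/\ forall j, 0 < r j,
        E `<=` \bigcup_j ball (c j) (r j)
      & s = (\sum_(0 <= j <oo) (f (2 * r j))%:E)%E]].

Definition L2norm (R : realType) (L : R) (v : R -> R) : \bar R :=
  Lnorm (@lebesgue_measure R) 2%:E (EFin \o (v \_ `]0, L[)).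

(* Solutions of the Dirichlet heat equation: [u t x] is continuous on
   ]0, +oo[ x [0, L], satisfies the equation classically on ]0, +oo[ x ]0, L[,
   and attains its initial value [u 0] in L^2(0, L).  By the maximum principle
   and L^2 continuity these are exactly the orbits of the heat semigroup. *)
Definition heat_solution (R : realType) (L : R) (u : R -> R -> R) : Prop :=
  [/\ {within [set z : R * R | 0 < z.1 /\ 0 <= z.2 <= L],
        continuous (fun z : R * R => u z.1 z.2)},
      forall t x : R, 0 < t -> 0 < x < L ->
        [/\ derivable (fun s => u s x) t 1,
            forall y : R, 0 < y < L -> derivable (u t) y 1,
            derivable (derive1 (u t)) x 1
          & derive1 (fun s => u s x) t = derive1n 2 (u t) x],
      forall t : R, 0 <= t -> u t 0 = 0 /\ u t L = 0,
      measurable_fun (`]0, L[ : set R) (u 0) /\ (L2norm L (u 0%R) < +oo)%E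
    & L2norm L (fun x => u t x - u 0 x) @[t --> 0^'+] --> 0%E].

Definition observable (R : realType) (L T : R) (E : set R) : Prop :=
  exists C : R, 0 < C /\ forall u : R -> R -> R, heat_solution L u ->
    (L2norm L (u T) <=
     C%:E * \int[@lebesgue_measure R]_(t in `[0%R, T])
              ereal_sup [set `|u t x|%:E | x in E])%E.

(* Main.v *)
(** For rapidly growing integers [n k], consider the set of all [x] in ]0, L[
    which, for every [k], lie at distance at most [delta_k = L / (q k * n k)],
    about [exp (- k * (n k) ^ 2)], to the right of a multiple of [L / n k].
    The Dirichlet modes of frequency [n k] are then smaller on this set
    than [exp (- T * (n k * pi / L) ^ 2)] by any prescribed factor, so
    observability fails.  The [n k] intervals of stage [k] have total [h_alpha]
    gauge at most [k ^ (- 1 / 2)], whereas [f_eps delta_k] is of order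
    [(k * (n k) ^ 2) ^ (- 1 / (2 + eps))], which beats the reciprocal of the
    number of intervals of stage [k] once the branching numbers [m k] are large.
    Reading mixed-radix digits therefore yields a map from [0, 1[ to the set
    whose inverse has modulus of continuity a multiple of [f_eps], and Lebesgue
    measure on [0, 1[ bounds the [f_eps] content from below. *)
Require Import Defs.
From mathcomp Require Import zify ring lra.
Set Implicit Arguments.
Unset Strict Implicit.
Unset Printing Implicit Defensive.
Local Open Scope classical_set_scope.
Local Open Scope ring_scope.

(** * Bounds for the Hausdorff content from above and below *)

Section hausdorff_content.
Context {R : realType}.
Implicit Types (f : R -> R) (E : set R).

Lemma gauge_small f e : gauge f -> 0 < e -> exists2 r, 0 < r & f (2 * r) < e.
Proof.
move=> [f0 _ _ fc] e0.
have /cvgrPdist_lt/(_ e e0) := fc.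
move=> [d /= d0 H].
exists (d / 4); first by rewrite divr_gt0.
have p : 0 < 2 * (d / 4) by rewrite mulr_gt0 ?divr_gt0.
have := H (2 * (d / 4)).
rewrite /= sub0r normrN gtr0_norm// sub0r normrN ger0_norm ?f0//; apply => //.
lra.
Qed.

(** The content is defined with infinite sequences of balls of positive radius. Since a gauge tends
    to [0] at [0], the [n] given balls can be completed by balls so small that their gauges add up
    to at most [e]. *)
Lemma content_le_finite_cover f E n (c : nat -> R) r : gauge f -> 0 < r ->
  (forall x, E x -> exists2 i, (i < n)%N & ball (c i) r x) ->
  (hausdorff_content f E <= (n%:R * f (2 * r))%:E)%E.
Proof.
move=> gf r0 Ec; apply/lee_addgt0Pr => e e0.
have e2 j : exists s, 0 < s /\ f (2 * s) < e / (2 ^ j.+1)%:R.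
  have [|s s0 fs] := @gauge_small f (e / (2 ^ j.+1)%:R) gf; last by exists s.
  by rewrite divr_gt0// ltr0n expn_gt0.
have [s /all_and2[s0 fs]] := choice e2.
pose rho j := if (j < n)%N then r else s j.
have rho0 j : 0 < rho j by rewrite /rho; case: ifP.
have f0 j : 0 <= f (2 * rho j) by case: gf => f0 _ _ _; rewrite f0 ?mulr_gt0.
have fr0 : 0 <= f (2 * r) by case: gf => f0' _ _ _; rewrite f0' ?mulr_gt0.
pose a j : \bar R := (if (j < n)%N then f (2 * r) else 0)%:E.
have a0 j : (0 <= a j)%E by rewrite /a lee_fin; case: ifP.
apply: (@le_trans _ _ (\sum_(0 <= j <oo) (f (2 * rho j))%:E)%E).
  apply: ereal_inf_lbound; exists c, rho; split => // x /Ec[i ilt xi].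
  by exists i => //; rewrite /rho ilt.
apply: (@le_trans _ _ (\sum_(0 <= j <oo) (a j + (e / (2 ^ j.+1)%:R)%:E))%E).
  apply: lee_nneseries => j _; first by rewrite lee_fin.
  rewrite /a /rho -EFinD lee_fin; case: ifP => _.
    by rewrite lerDl divr_ge0 ?ltW.
  by rewrite add0r ltW.
apply: (le_trans (epsilon_trick _ a0 (ltW e0))); rewrite leeD2r//.
rewrite (nneseries_split 0 n)//= ?add0n big_mkord.
under eq_bigr do rewrite /a ltn_ord.
have -> : (\sum_(n <= k <oo) a k = 0)%E.

  by apply: eseries0 => j nj _; rewrite /a ltnNge nj.
by rewrite adde0 sumEFin sumr_const card_ord [n%:R * _]mulr_natl.
Qed.

(* If [s - t] is controlled by [f] of the distance of the images, then the
   preimage of a ball of radius [r] has length at most [2 * C * f (2 * r)], and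
   such preimages cover [0, 1[. *)
Lemma content_gt0_of_param f E (phi : R -> R) (C : R) : gauge f -> 0 < C ->
  (forall t, 0 <= t < 1 -> E (phi t)) ->
  (forall s t, 0 <= s < t -> t < 1 ->
     exists d, [/\ 0 < d, d <= `|phi s - phi t| & t - s <= C * f d]) ->
  (0 < hausdorff_content f E)%E.
Proof.
move=> gf C0 Ephi phiC; have [f0 f1 _ _] := gf.
apply: (@lt_le_trans _ _ ((2 * C)^-1)%:E).
  by rewrite lte_fin invr_gt0 mulr_gt0.
apply: le_ereal_inf_tmp => _ [c [r [r0 Ec ->]]].
have fr0 j : 0 <= f (2 * r j) by rewrite f0 ?mulr_gt0.
pose P j t := 0 <= t < 1 /\ ball (c j) (r j) (phi t).
have Pd j s t : P j s -> P j t -> `|s - t| <= C * f (2 * r j).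
  wlog st : s t / s < t.
    move=> W Ps Pt; have [st|ts|->] := ltgtP s t; first exact: W.
      by rewrite distrC; exact: W.
    by rewrite subrr normr0 mulr_ge0// ltW.
  move=> [/andP[s0 _] bs] [/andP[_ t1] bt].
  have [|d [d0 dd]] := @phiC s t _ t1; first by rewrite s0.
  rewrite distrC gtr0_norm ?subr_gt0// => /le_trans; apply.
  rewrite ler_pM2l// ltW//; apply: f1 => //; apply: (le_lt_trans dd).
  move: bs bt; rewrite /ball/= => bs bt.
  have -> : phi s - phi t = (phi s - c j) + (c j - phi t) by rewrite addrA subrK.
  by rewrite (le_lt_trans (ler_normD _ _))// distrC mulrDl mul1r ltrD.
(* One reference point is chosen in each preimage, [0] by default when the preimage is empty. By
   [Pd], the interval [I j] of half-width [C * f (2 * r j)] around it contains the whole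
   preimage. *)
have exP j : exists y, (exists t, P j t) -> P j y.
  by have [[t Pt]|N] := pselect (exists t, P j t); [exists t | exists 0 => /N].
have [p Pp] := choice exP.
pose I j := `[p j - C * f (2 * r j), p j + C * f (2 * r j)]%classic.
have mI j : measurable (I j) by exact: measurable_itv.
have : (lebesgue_measure (`[0%R, 1%R[%classic : set R) <=
    \sum_(j <oo) lebesgue_measure (I j))%E.
  apply: measure_sigma_subadditive => // t /=; rewrite in_itv/= => t01.
  have [j _ bj] := Ec _ (Ephi _ t01); exists j => //=.
  have Pt : P j t by [].
  have := Pd _ _ _ (Pp j (ex_intro _ t Pt)) Pt.
  rewrite ler_distlC => /andP[h1 h2]; rewrite /I/= in_itv/=; apply/andP; split; lra.
rewrite lebesgue_measure_itv/= lte_fin ltr01 oppr0 adde0.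
have -> : (\sum_(j <oo) lebesgue_measure (I j) =
    (2 * C)%:E * \sum_(0 <= j <oo) (f (2 * r j))%:E)%E.
  rewrite -nneseriesZl; last by move=> j _; rewrite lee_fin.
  apply: eq_eseriesr => j _; rewrite lebesgue_measure_itv/= lte_fin.
  case: ifPn => [_|]; first by rewrite -EFinD -EFinM; congr EFin; ring.
  (* A degenerate [I j] has length [0], which agrees with the formula because it forces
     [f (2 * r j) = 0]. *)
  rewrite -leNgt => h.
  have -> : f (2 * r j) = 0.
    have := fr0 j; rewrite le_eqVlt => /orP[/eqP <-//|fp].
    have : 0 < C * f (2 * r j) by rewrite mulr_gt0.
    lra.
  by rewrite mule0.
set S := (\sum_(0 <= j <oo) _)%E => S1.
by rewrite -(@lee_pmul2l _ (2 * C)%:E)// -?EFinM ?divff// ?gt_eqF ?lte_fin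
  ?mulr_gt0.
Qed.

End hausdorff_content.

(** * Sine modes of the heat equation and failure of observability *)

Section heat_mode.
Context {R : realType}.
Implicit Types (L k t : R).

Lemma norm_sin_le (x : R) : `|sin x| <= `|x|.
Proof.
wlog x0 : x / 0 < x.
  move=> W; have [x0|x0|<-] := ltgtP 0 x; first exact: W.
    by rewrite -normrN -sinN -(normrN x) W// oppr_gt0.
  by rewrite sin0.
have [|c _] := @MVT R sin cos 0 x x0 (fun y _ => is_derive_sin y).
  by apply: continuous_subspaceT => y; exact: continuous_sin.
rewrite sin0 !subr0 => ->.
by rewrite normrM ler_piMl// cos_max.
Qed.

Lemma norm_sin_natpiD n (x : R) : `|sin (n%:R * pi + x)| = `|sin x|.
Proof.
elim: n => [|n IH]; first by rewrite mul0r add0r.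
by rewrite -natr1 mulrDl mul1r addrAC sinDpi normrN.
Qed.

(* No measurability is required: both sides are suprema over simple functions. *)
Lemma le_integral_ge0 d (T : measurableType d) (mu : {measure set T -> \bar R})
    (D : set T) (f g : T -> \bar R) :
  (forall x, D x -> (0 <= f x)%E) -> (forall x, D x -> (f x <= g x)%E) ->
  (\int[mu]_(x in D) f x <= \int[mu]_(x in D) g x)%E.
Proof.
move=> f0 fg; rewrite !ge0_integralE//; last first.
  by move=> x Dx; rewrite (le_trans (f0 x Dx))// fg.
apply: le_ereal_sup => _ [h hf <-]; exists h => // x; apply: (le_trans (hf x)).
by rewrite /patch; case: ifPn => //; rewrite inE => /fg.
Qed.

Lemma L2normE L (v : R -> R) :
  L2norm L v =
  ((\int[@lebesgue_measure R]_(x in `]0%R, L[) (v x ^+ 2)%:E) `^ 2^-1)%E.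
Proof.
rewrite /L2norm unlock [in RHS]integral_mkcond; congr (_ `^ _)%E.
apply: eq_integral => x _ /=; rewrite /patch; case: ifP => _.
  by rewrite powR_mulrn// real_normK// num_real.
(* Outside []0, L[] the restriction takes the default value [point], which is [0] in [R]. *)
by rewrite (_ : point = 0 :> R)// normr0 powR0.
Qed.

Lemma L2norm_le L (v : R -> R) (M : R) : 0 < L -> 0 <= M ->
  (forall x, 0 < x < L -> `|v x| <= M) ->
  (L2norm L v <= (M * Num.sqrt L)%:E)%E.
Proof.
move=> L0 M0 vM; rewrite L2normE.
have -> : (M * Num.sqrt L)%:E = (((M ^+ 2 * L)%:E) `^ 2^-1)%E.
  rewrite poweR_EFin powR12_sqrt ?mulr_ge0 ?sqr_ge0 ?(ltW L0)//.
  by rewrite sqrtrM ?sqr_ge0// sqrtr_sqr ger0_norm.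
have v0 x : (0 <= (v x ^+ 2)%:E)%E by rewrite lee_fin sqr_ge0.
apply: gt0_ler_poweR.
- by rewrite invr_ge0.
- by rewrite in_itv/= leey andbT integral_ge0.
- by rewrite in_itv/= leey andbT lee_fin mulr_ge0 ?sqr_ge0 ?(ltW L0).
have -> : (M ^+ 2 * L)%:E =
    (\int[@lebesgue_measure R]_(x in `]0%R, L[) (M ^+ 2)%:E)%E.
  by rewrite integral_cst//= lebesgue_measure_itv/= lte_fin L0 -EFinD subr0.
apply: le_integral_ge0 => [x _|x]; first exact: v0.
rewrite /= in_itv/= => /vM.
by rewrite lee_fin -[v x ^+ 2]real_normK ?num_real// ler_pXn2r ?nnegrE.
Qed.

Lemma L2norm_ge L (v : R -> R) (M a b : R) : 0 <= M -> 0 <= a -> a < b -> b <= L ->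
  (forall x, a < x < b -> M <= `|v x|) ->
  ((M * Num.sqrt (b - a))%:E <= L2norm L v)%E.
Proof.
move=> M0 a0 ab bL vM; rewrite L2normE.
have ba : 0 <= b - a by rewrite subr_ge0 ltW.
have -> : (M * Num.sqrt (b - a))%:E = (((M ^+ 2 * (b - a))%:E) `^ 2^-1)%E.
  rewrite poweR_EFin powR12_sqrt ?mulr_ge0 ?sqr_ge0//.
  by rewrite sqrtrM ?sqr_ge0// sqrtr_sqr ger0_norm.
have v0 x : (0 <= (v x ^+ 2)%:E)%E by rewrite lee_fin sqr_ge0.
apply: gt0_ler_poweR.
- by rewrite invr_ge0.
- by rewrite in_itv/= leey andbT lee_fin mulr_ge0 ?sqr_ge0.
- by rewrite in_itv/= leey andbT integral_ge0.
have -> : (M ^+ 2 * (b - a))%:E =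
    (\int[@lebesgue_measure R]_(x in `]a%R, b%R[) (M ^+ 2)%:E)%E.
  by rewrite integral_cst//= lebesgue_measure_itv/= lte_fin ab -EFinD.
rewrite integral_mkcond [leRHS]integral_mkcond.
apply: le_integral_ge0 => x _.
  by rewrite /patch; case: ifP; rewrite // lee_fin sqr_ge0.
rewrite /patch; case: ifPn => [|_]; last by case: ifP.
rewrite inE/= in_itv/= => xab.
rewrite ifT; last first.
  rewrite inE/= in_itv/=; case/andP: xab => ax xb.
  by rewrite (le_lt_trans a0 ax) (lt_le_trans xb bL).
by rewrite lee_fin -[v x ^+ 2]real_normK ?num_real// ler_pXn2r ?nnegrE// vM.
Qed.

Definition heat_mode k t (x : R) := expR (- (k ^+ 2 * t)) * sin (k * x).

Lemma is_derive_heat_mode_t k t (x : R) :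
  is_derive t 1 (fun s => heat_mode k s x) (- (k ^+ 2) * heat_mode k t x).
Proof.
rewrite /heat_mode; apply: is_derive_eq.
rewrite scaler0 add0r /GRing.scale/= mulr1; ring.
Qed.

Lemma is_derive_heat_mode_x k t (x : R) :
  is_derive x 1 (heat_mode k t) (expR (- (k ^+ 2 * t)) * (k * cos (k * x))).
Proof.
rewrite /heat_mode; apply: is_derive_eq.
rewrite /GRing.scale/= mulr1; ring.
Qed.

Lemma is_derive_heat_mode_xx k t (x : R) :
  is_derive x 1 (derive1 (heat_mode k t)) (- (k ^+ 2) * heat_mode k t x).
Proof.
rewrite (_ : derive1 _ =
    (fun y => expR (- (k ^+ 2 * t)) * (k * cos (k * y)))); last first.
  by apply/funext => y; rewrite derive1E (@derive_val _ _ _ _ _ _ _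
    (is_derive_heat_mode_x k t y)).
rewrite /heat_mode; apply: is_derive_eq.
rewrite /GRing.scale/= mulr1; ring.
Qed.

Lemma norm_heat_mode_le1 k t (x : R) : 0 <= t -> `|heat_mode k t x| <= 1.
Proof.
move=> t0; rewrite normrM -[leRHS]mulr1 ler_pM ?sin_max//.
by rewrite ger0_norm ?expR_ge0// expR_le1 oppr_le0 mulr_ge0 ?sqr_ge0.
Qed.

Lemma heat_mode_solution L k : 0 < L -> sin (k * L) = 0 ->
  heat_solution L (heat_mode k).
Proof.
move=> L0 kL; split.
- apply: continuous_subspaceT => z; rewrite /heat_mode.
  apply: cvgM; apply: continuous_comp; try exact: continuous_expR;
    try exact: continuous_sin.
    by apply: cvgN; apply: cvgMr; exact: cvg_fst.
  by apply: cvgMr; exact: cvg_snd.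
- move=> t x t0 _; split.
  + exact: (@ex_derive _ _ _ _ _ _ _ (is_derive_heat_mode_t k t x)).
  + by move=> y _; exact: (@ex_derive _ _ _ _ _ _ _ (is_derive_heat_mode_x k t y)).
  + exact: (@ex_derive _ _ _ _ _ _ _ (is_derive_heat_mode_xx k t x)).
  + rewrite derive1E (@derive_val _ _ _ _ _ _ _ (is_derive_heat_mode_t k t x)).
    rewrite derive1nS /= derive1E.
    by rewrite (@derive_val _ _ _ _ _ _ _ (is_derive_heat_mode_xx k t x)).
- by move=> t _; rewrite /heat_mode mulr0 sin0 kL mulr0.
- split.
    apply: measurable_funTS.
    apply: measurable_realfun.continuous_measurable_fun => x.
    rewrite /heat_mode; apply: cvgMr; apply: continuous_comp; last first.
      exact: continuous_sin.
    exact: mulrl_continuous.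
  apply: (@le_lt_trans _ _ (1 * Num.sqrt L)%:E); last exact: ltry.
  by apply: L2norm_le => // x _; exact: norm_heat_mode_le1.
- apply: (@squeeze_cvge _ _ _ _ (cst 0%E) _
    (fun t : R => (k ^+ 2 * t * Num.sqrt L)%:E)).
  + near=> t.
    have t0 : 0 < t by near: t; exact: nbhs_right_gt.
    rewrite /cst L2normE poweR_ge0/= -L2normE.
    apply: L2norm_le => //; first by rewrite mulr_ge0 ?sqr_ge0 ?ltW.
    move=> x _; rewrite /heat_mode mulr0 oppr0 expR0 -mulrBl normrM.
    (* Convergence to the initial value follows from [0 <= 1 - exp (- s) <= s] with
       [s = k ^+ 2 * t]. *)
    have e1 := expR_ge1Dx (- (k ^+ 2 * t)).
    have e2 : expR (- (k ^+ 2 * t)) <= 1.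
      by rewrite expR_le1 oppr_le0 mulr_ge0 ?sqr_ge0 ?ltW.
    rewrite -[leRHS]mulr1 ler_pM ?sin_max// ler0_norm; lra.
  + exact: cvg_cst.
  + apply: cvg_EFin; first by near=> t.
    rewrite /comp/=.
    have : k ^+ 2 * t * Num.sqrt L @[t --> 0^'+] --> k ^+ 2 * 0 * Num.sqrt L.
      apply: (@cvg_at_right_filter _ _ (fun t => k ^+ 2 * t * Num.sqrt L)).
      by apply: cvgMl; apply: cvgMr; exact: cvg_id.
    by rewrite mulr0 mul0r.
Unshelve. all: by end_near.
Qed.

End heat_mode.
(** The inequality is tested on the mode of frequency [k = n * pi / L]. Its norm at time [T] is at
    least [c * exp (- k ^+ 2 * T) / n], while the observed integral is at most [S * T]. The
    hypothesis for [K = C * T / c] makes these incompatible. *)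
Lemma not_observable (R : realType) (L T : R) (E : set R) :
  0 < L -> 0 < T -> E !=set0 ->
  (forall K : R, 0 < K -> exists n (S : R), [/\ (0 < n)%N,
     forall x, E x -> `|sin (n%:R * pi / L * x)| <= S
   & K * n%:R * S < expR (- ((n%:R * pi / L) ^+ 2 * T))]) ->
  ~ observable L T E.
Proof.
move=> L0 T0 [x0 Ex0] H [C [C0 obs]].
have pi0 := pi_gt0 R; have pi2 := pi_ge2 R.
(* The mode is at least half its amplitude on an interval of length [2 / k = (2 * L / pi) / n].
   Weakening the square root of [1 / n] to [1 / n] leaves this constant. *)
pose c := Num.sqrt (2 * L / pi) / 2.
have c0 : 0 < c by rewrite divr_gt0// sqrtr_gt0 divr_gt0// mulr_gt0.
have [|n [S [n0 ES KS]]] := H (C * T / c); first by rewrite divr_gt0// mulr_gt0.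
set k := n%:R * pi / L in ES KS.
have n1 : 1 <= n%:R :> R by rewrite ler1n.
have k0 : 0 < k by rewrite divr_gt0// mulr_gt0// (lt_le_trans ltr01).
have kL : k * L = n%:R * pi by rewrite divfK// gt_eqF.
have sol : heat_solution L (heat_mode k).
  apply: heat_mode_solution => //; apply/eqP.
  by rewrite kL -normr_eq0 -[_ * _]addr0 norm_sin_natpiD sin0 normr0.
have e0 := expR_gt0 (- (k ^+ 2 * T)).
(* The interval has half-width [1 / k] around the first maximum [pi / (2 * k)]. With
   [k * x = pi / 2 + z] and [z] between [-1] and [1], [cos z = 1 - 2 * sin (z / 2) ^+ 2] is at least
   [1 / 2]. It stays inside [[0, L]] since [pi >= 2]. *)
have : (((expR (- (k ^+ 2 * T)) / 2) *
    Num.sqrt ((pi / 2 + 1) / k - (pi / 2 - 1) / k))%:E <=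
    L2norm L (heat_mode k T))%E.
  apply: L2norm_ge.
  - by rewrite divr_ge0// ltW.
  - by rewrite divr_ge0 ?(ltW k0)//; lra.
  - by rewrite ltr_pM2r ?invr_gt0//; lra.
  - rewrite ler_pdivrMr// [L * k]mulrC kL.
    have : pi <= n%:R * pi :> R by rewrite ler_peMl// ltW.
    lra.
  move=> x; rewrite ltr_pdivrMr// ltr_pdivlMr// => /andP[h1 h2].
  rewrite normrM ger0_norm ?(ltW e0)// ler_pM2l//.
  have -> : k * x = (x * k - pi / 2) + pi / 2 by ring.
  rewrite sinDpihalf; set z := x * k - _.
  have -> : z = (z / 2) *+ 2 by rewrite -mulr_natr divfK.
  have -> : cos ((z / 2) *+ 2) = 1 - 2 * sin (z / 2) ^+ 2.
    have := cos2Dsin2 (z / 2); rewrite mulr2n cosD -!expr2; lra.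
  have z1 : `|sin (z / 2)| <= 1 / 2.
    apply: (le_trans (norm_sin_le _)).
    by rewrite ler_norml; apply/andP; split; rewrite /z; lra.
  have : sin (z / 2) ^+ 2 <= 1 / 4.
    rewrite -real_normK ?num_real//.
    have := normr_ge0 (sin (z / 2)); nra.
  move=> h; apply: le_trans (ler_norm _); lra.
rewrite (_ : _ - _ = 2 / k); last by field; rewrite gt_eqF.
(* Nonemptiness of [E] enters here: the supremum over the empty set would be [-oo]. *)
have sup0 t : (0 <= ereal_sup [set `|heat_mode k t x|%:E | x in E])%E.
  apply: (@le_trans _ _ `|heat_mode k t x0|%:E); first by rewrite lee_fin.
  by apply: ereal_sup_ubound; exists x0.
have S0 : 0 <= S := le_trans (normr_ge0 _) (ES _ Ex0).
have supS t : t \in `[0, T] ->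
    (ereal_sup [set `|heat_mode k t x|%:E | x in E] <= S%:E)%E.
  rewrite in_itv/= => /andP[t0 _]; apply: ge_ereal_sup => _ [x Ex <-].
  rewrite lee_fin normrM -[leRHS]mul1r ler_pM ?ES//.
  by rewrite ger0_norm ?expR_ge0// expR_le1 oppr_le0 mulr_ge0 ?sqr_ge0.
have intS : (\int[@lebesgue_measure R]_(t in `[0%R, T])
    ereal_sup [set `|heat_mode k t x|%:E | x in E] <= (S * T)%:E)%E.
  have -> : (S * T)%:E = (\int[@lebesgue_measure R]_(t in `[0%R, T]) S%:E)%E.
    by rewrite integral_cst//= lebesgue_measure_itv/= lte_fin T0 -EFinD subr0.
  by apply: le_integral_ge0.
move=> /le_trans/(_ (obs _ sol)).
have h2 : (C%:E * \int[@lebesgue_measure R]_(t in `[0%R, T])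
    ereal_sup [set `|heat_mode k t x|%:E | x in E] <= (C * (S * T))%:E)%E.
  by rewrite EFinM lee_pmul2l ?lte_fin.
move=> /le_trans/(_ h2); rewrite lee_fin.
have -> : 2 / k = (2 * L / pi) / n%:R.
  rewrite /k; move: (pi : R) pi0 => p p0; field.
  by rewrite !gt_eqF// (lt_le_trans ltr01).
have a0 : 0 <= 2 * L / pi by rewrite divr_ge0 ?mulr_ge0 ?ltW.
have sqn : Num.sqrt (2 * L / pi) / n%:R <= Num.sqrt (2 * L / pi / n%:R).
  rewrite (sqrtrM n%:R^-1 a0) ler_wpM2l ?sqrtr_ge0//.
  rewrite -[leLHS]ger0_norm ?invr_ge0// -sqrtr_sqr ler_wsqrtr//.
  by rewrite expr2 ler_piMl ?invr_ge0// invf_le1// (lt_le_trans ltr01).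
have : c * expR (- (k ^+ 2 * T)) <=
    n%:R * (expR (- (k ^+ 2 * T)) / 2 * Num.sqrt (2 * L / pi / n%:R)).
  have nn0 : n%:R != 0 :> R by rewrite gt_eqF// (lt_le_trans ltr01).
  have -> : c * expR (- (k ^+ 2 * T)) = n%:R * (expR (- (k ^+ 2 * T)) / 2 *
      (Num.sqrt (2 * L / pi) / n%:R)) by rewrite /c; field.
  by rewrite ler_pM2l ?(lt_le_trans ltr01)// ler_pM2l ?divr_gt0.
move=> h3 h4.
have h5 : c * expR (- (k ^+ 2 * T)) <= n%:R * (C * (S * T)).
  by apply: (le_trans h3); rewrite ler_pM2l// (lt_le_trans ltr01).
move: KS; rewrite ltNge => /negP; apply.
have -> : C * T / c * n%:R * S = n%:R * (C * (S * T)) / c by field; rewrite gt_eqF.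
by rewrite ler_pdivlMr// mulrC.
Qed.

(** * The Cantor-type set and its mixed-radix parametrization *)

Section lacunary_set.
Context {R : realType}.
Variables (L : R) (n m q : nat -> nat).

Definition lacunary_set : set R := [set x | 0 < x < L /\ forall k, exists i : nat,
  i%:R * L / (n k)%:R <= x <= i%:R * L / (n k)%:R + L / (q k * n k)%:R].

Hypotheses (L0 : 0 < L) (n0 : n 0 = 2%N)
  (nS : forall k, n k.+1 = (m k * (q k * n k))%N)
  (m2 : forall k, (1 < m k)%N) (q2 : forall k, (1 < q k)%N).

Local Notation M k := (\prod_(i < k) m i)%N.

(* [t] in [0, 1[ has digits [digit_prefix k.+1 t %% m k] in the mixed radix
   [m]; the same digits select the nested intervals
   [node k t * L / n k, node k t * L / n k + L / (q k * n k)]. *)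
Definition digit_prefix k (t : R) := Num.truncn (t * (M k)%:R).

Fixpoint node k (t : R) : nat :=
  if k is j.+1 then (node j t * (m j * q j) + digit_prefix k t %% m j)%N else 1.

Definition param (t : R) : R :=
  sup (range (fun k => (node k t)%:R * L / (n k)%:R)).

Let n_gt0 k : (0 < n k)%N.
Proof.
elim: k => [|k IH]; first by rewrite n0.
by rewrite nS !muln_gt0 IH (ltnW (m2 k)) (ltnW (q2 k)).
Qed.

Let MS k : M k.+1 = (M k * m k)%N.
Proof. by rewrite big_ord_recr. Qed.

Let M_gt k : (k < M k)%N.
Proof.
elim: k => [|k IH]; first by rewrite big_ord0.
rewrite MS; have := m2 k; nia.
Qed.

Let left_endpoint k t := (node k t)%:R * L / (n k)%:R.

Let left_endpointS k t : left_endpoint k.+1 t =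
  left_endpoint k t + (digit_prefix k.+1 t %% m k)%N%:R * L / (n k.+1)%:R.
Proof.
rewrite /left_endpoint /= nS natrD !natrM.
have := n_gt0 k; have := ltnW (m2 k); have := ltnW (q2 k).
rewrite -!(ltr_nat R) => h1 h2 h3.
by field; rewrite !gt_eqF.
Qed.

Let left_endpoint_nondecreasing k t : left_endpoint k t <= left_endpoint k.+1 t.
Proof. by rewrite left_endpointS lerDl divr_ge0 ?mulr_ge0// ltW. Qed.

(** In units of [L / n k.+1] the parent interval has length [m k], the child starts at a digit at
    most [m k - 1], and its length is at most one unit. *)
Let right_endpoint_nonincreasing k t :
  left_endpoint k.+1 t + L / (q k.+1 * n k.+1)%:R <=
  left_endpoint k t + L / (q k * n k)%:R.
Proof.
rewrite left_endpointS -addrA lerD2l.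
have N0 : 0 < (n k.+1)%:R :> R by rewrite ltr0n.
have -> : L / (q k * n k)%:R = (m k)%:R * L / (n k.+1)%:R.
  rewrite nS !natrM.
  have := n_gt0 k; have := ltnW (m2 k); have := ltnW (q2 k).
  rewrite -!(ltr_nat R) => h1 h2 h3.
  by field; rewrite !gt_eqF.
rewrite natrM invfM [L * _]mulrA -mulrDl ler_pM2r ?invr_gt0//.
have : (digit_prefix k.+1 t %% m k < m k)%N by rewrite ltn_mod ltnW.
rewrite -(ler_nat R) -natr1 => /(ler_wpM2r (ltW L0)).
have : (q k.+1)%:R^-1 <= 1 :> R.
  by rewrite invf_le1 ?ltr0n ?ler1n ltnW.
move=> /(ler_wpM2l (ltW L0)); lra.
Qed.

Let left_le_right k l t : left_endpoint k t <=
  left_endpoint l t + L / (q l * n l)%:R.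
Proof.
have lr j : left_endpoint j t <= left_endpoint j t + L / (q j * n j)%:R.
  by rewrite lerDl divr_ge0// ltW.
have /nondecreasing_seqP nd := left_endpoint_nondecreasing^~ t.
have /nonincreasing_seqP ni := right_endpoint_nonincreasing^~ t.
have [/nd kl|/ltnW/ni lk] := leqP k l; first exact: le_trans (lr l).
exact: (le_trans (lr k)).
Qed.

(** By nesting, each left endpoint lies below every right endpoint, so the supremum of the left
    endpoints belongs to all the closed intervals. *)
Lemma param_itv k t : (node k t)%:R * L / (n k)%:R <= param t <=
  (node k t)%:R * L / (n k)%:R + L / (q k * n k)%:R.
Proof.
have ub l : ubound (range (left_endpoint^~ t))
    (left_endpoint l t + L / (q l * n l)%:R).
  by move=> _ [j _ <-]; exact: left_le_right.
apply/andP; split.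
  by apply: ub_le_sup; [exists (left_endpoint 0 t + L / (q 0 * n 0)%:R)|exists k].
by apply: ge_sup; [exists (left_endpoint 0 t); exists 0|exact: ub].
Qed.

Lemma param_lacunary t : lacunary_set (param t).
Proof.
split; last by move=> k; exists (node k t); exact: param_itv.
(* Starting from [n 0 = 2] and [node 0 t = 1] keeps the point between [L / 2] and [3 * L / 4], away
   from both ends. *)
have := param_itv 0 t; rewrite /= n0 mul1r => /andP[h1 h2].
have : L / (q 0 * 2)%:R <= L / 4.
  rewrite ler_pM2l// lef_pV2 ?posrE ?ltr0n ?muln_gt0 ?(ltnW (q2 0))//.
  by rewrite (ler_nat _ 4); have := q2 0; lia.
move: (L / (q 0 * 2)%:R) (param t) h1 h2 => z y h1 h2 h3.
have L0' : (0 : R) < L by exact: L0.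
apply/andP; split; lra.
Qed.

Lemma digit_prefixS k t : 0 <= t ->
  digit_prefix k t = (digit_prefix k.+1 t %/ m k)%N.
Proof.
move=> t0; rewrite /digit_prefix MS natrM mulrA; set x := t * _.
have x0 : 0 <= x by rewrite mulr_ge0.
have mk : (0 < m k)%N := ltnW (m2 k).
have mk0 : 0 < (m k)%:R :> R by rewrite ltr0n.
have xm0 : 0 <= x * (m k)%:R by rewrite mulr_ge0// ltW.
apply/eqP; rewrite truncn_eq//; have /andP[h1 h2] := truncn_itv xm0.
set N := Num.truncn _ in h1 h2 *; apply/andP; split.
  rewrite -(ler_pM2r mk0); apply: le_trans h1.
  by rewrite -natrM ler_nat leq_divM.
rewrite -(ltr_pM2r mk0); apply: (lt_le_trans h2).
by rewrite -natrM ler_nat ltn_ceil.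
Qed.

Lemma eq_node k s t :
  (forall j, (j <= k)%N -> digit_prefix j s = digit_prefix j t) ->
  node k s = node k t.
Proof.
elim: k => // k IH st /=; rewrite IH ?st// => j jk.
by rewrite st// leqW.
Qed.

(** Take the first stage [k.+1] at which the prefixes differ, and let [J] be their difference. The
    two intervals share a parent and start [J * L / n k.+1] apart. Since [q >= 2], each is at most
    half a step long, so at least half of this distance survives. In the parameter,
    [(t - s) * M k.+1 < J + 1 <= 2 * J]. *)
Lemma param_separated s t : 0 <= s < t -> t < 1 -> exists k (J : nat),
  [/\ (0 < J <= m k)%N, J%:R * L / (2 * (n k.+1)%:R) <= `|param s - param t|
    & t - s <= 2 * J%:R / (M k.+1)%:R].
Proof.
move=> /andP[s0 st] t1; have t0 : 0 <= t by rewrite (le_trans s0)// ltW.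
have M0 k : 0 < (M k)%:R :> R by rewrite ltr0n (leq_trans _ (M_gt k)).
have ex : exists k, digit_prefix k s != digit_prefix k t.
  (* As [M k > k], this stage has [M k * (t - s) > 1], which forces distinct integer parts. *)
  exists (Num.truncn (t - s)^-1).+1; set k := (Num.truncn _).+1.
  have : (t - s)^-1 < (M k)%:R.
    by rewrite (lt_trans (truncnS_gt _))// ltr_nat M_gt.
  rewrite invf_plt ?posrE ?subr_gt0// -[_^-1]mul1r ltr_pdivrMr// => h.
  apply/eqP => e.
  have /andP[h1 h2] := truncn_itv (mulr_ge0 s0 (ltW (M0 k))).
  have /andP[h3 h4] := truncn_itv (mulr_ge0 t0 (ltW (M0 k))).
  move: e h1 h2 h3 h4; rewrite /digit_prefix => ->; rewrite -natr1; lra.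
(* Stage [0] cannot be the first one: [M 0 = 1], so both prefixes are [0]. *)
case: (ex_minnP ex) => -[|k] neq mink.
  move: neq; rewrite /digit_prefix big_ord0 !mulr1.
  by rewrite !(truncn_def (n := 0)) ?s0 ?t0 ?t1 ?(lt_trans st t1).
have eqk j : (j <= k)%N -> digit_prefix j s = digit_prefix j t.
  by move=> jk; apply/eqP; apply: contraT => /mink; rewrite ltnNge jk.
have le : (digit_prefix k.+1 s <= digit_prefix k.+1 t)%N.
  by apply: le_truncn; rewrite ler_pM2r// ltW.
have eqdiv := eqk k (leqnn k).
rewrite (digit_prefixS k s0) (digit_prefixS k t0) in eqdiv.
have es := divn_eq (digit_prefix k.+1 s) (m k).
have et := divn_eq (digit_prefix k.+1 t) (m k).
have lts : (digit_prefix k.+1 s %% m k < m k)%N by rewrite ltn_mod ltnW.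
have ltt : (digit_prefix k.+1 t %% m k < m k)%N by rewrite ltn_mod ltnW.
set ps := digit_prefix k.+1 s in neq le eqdiv es lts.
set pt := digit_prefix k.+1 t in neq le eqdiv et ltt.
have JE : (pt %% m k = ps %% m k + (pt - ps))%N.
  move: es et le; rewrite eqdiv.
  by move: (_ * m k)%N (ps %% _)%N (pt %% _)%N => x y z; lia.
have J0 : (0 < pt - ps)%N by rewrite subn_gt0 ltn_neqAle neq.
exists k, (pt - ps)%N; split.
- by rewrite J0/=; move: JE ltt; move: (pt - ps)%N => J; lia.
- have /andP[_ h1] := param_itv k.+1 s; have /andP[h2 _] := param_itv k.+1 t.
  have hs := left_endpointS k s; have ht := left_endpointS k t.
  rewrite /left_endpoint (eq_node eqk) -/ps in hs.
  rewrite /left_endpoint -/pt in ht.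
  rewrite hs in h1; rewrite ht in h2.
  rewrite distrC; apply: le_trans (ler_norm _).
  rewrite JE natrD !mulrDl in h2.
  have N0 : 0 < (n k.+1)%:R :> R by rewrite ltr0n.
  have : L / (q k.+1 * n k.+1)%:R <= L / (2 * (n k.+1)%:R).
    rewrite ler_pM2l// lef_pV2 ?posrE ?mulr_gt0// ?ltr0n ?muln_gt0 ?n_gt0 ?andbT.
      by rewrite natrM ler_pM2r// ler_nat.
    exact: ltnW.
  have : L / (2 * (n k.+1)%:R) <= (pt - ps)%N%:R * L / (2 * (n k.+1)%:R).
    by rewrite ler_pM2r ?invr_gt0 ?mulr_gt0// ler_peMl ?ler1n// ltW.
  have e : (pt - ps)%N%:R * L / (n k.+1)%:R =
    2 * ((pt - ps)%N%:R * L / (2 * (n k.+1)%:R)) :> R by field; rewrite gt_eqF.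
  rewrite e in h2; move: h1 h2.
  move: (_ * L / _) (_ * L / _) (_ * L / _) (L / _) (L / _) => x y z u v.
  lra.
- rewrite ler_pdivlMr// mulrBl.
  have /andP[h1 _] := truncn_itv (mulr_ge0 s0 (ltW (M0 k.+1))).
  have /andP[_ h4] := truncn_itv (mulr_ge0 t0 (ltW (M0 k.+1))).
  rewrite -/(digit_prefix _ _) -/ps in h1; rewrite -/(digit_prefix _ _) -/pt in h4.
  move: h4; rewrite -natr1 -{1}(subnK le) natrD.
  have : 1 <= (pt - ps)%N%:R :> R by rewrite ler1n.
  lra.
Qed.

(** The separation of siblings [J] steps apart is [theta = J / m k] times half the parent length.
    The scaling hypothesis therefore reduces every [J] to the one estimate per stage, and gives
    [f d >= c * J / M k.+1]. *)
Lemma content_lacunary_gt0 (f : R -> R) (tau c : R) : gauge f -> 0 < c ->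
  (forall theta t, 0 < theta <= 1 -> 0 < t <= tau -> theta * f t <= f (theta * t)) ->
  (forall k, L / (2 * (q k * n k)%:R) <= tau) ->
  (forall k, c / (M k)%:R <= f (L / (2 * (q k * n k)%:R))) ->
  (0 < hausdorff_content f lacunary_set)%E.
Proof.
move=> gf c0 ftheta le_tau Mf.
apply: (@content_gt0_of_param _ _ _ param (2 / c)) => //.
- by rewrite divr_gt0.
- by move=> t _; exact: param_lacunary.
move=> s t st t1; have [k [J [/andP[J0 Jm] Jd Jts]]] := param_separated st t1.
have N0 : 0 < (n k.+1)%:R :> R by rewrite ltr0n.
have M0 j : 0 < (M j)%:R :> R by rewrite ltr0n (leq_trans _ (M_gt j)).
have J0' : 0 < J%:R :> R by rewrite ltr0n.
exists (J%:R * L / (2 * (n k.+1)%:R)); split => //.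
  by rewrite divr_gt0// mulr_gt0.
apply: (le_trans Jts).
have qn0 : 0 < (q k * n k)%:R :> R by rewrite ltr0n muln_gt0 n_gt0 ltnW.
have m0 : 0 < (m k)%:R :> R by rewrite ltr0n ltnW.
have -> : J%:R * L / (2 * (n k.+1)%:R) =
    J%:R / (m k)%:R * (L / (2 * (q k * n k)%:R)).
  by rewrite nS !natrM; field; rewrite !gt_eqF// ltr0n ?n_gt0// ltnW.
have h1 : J%:R / (m k)%:R * f (L / (2 * (q k * n k)%:R)) <=
    f (J%:R / (m k)%:R * (L / (2 * (q k * n k)%:R))).
  apply: ftheta; rewrite ?le_tau ?andbT ?divr_gt0 ?mulr_gt0//=.
  by rewrite ler_pdivrMr// mul1r ler_nat.
have h2 : J%:R / (m k)%:R * (c / (M k)%:R) <=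
    J%:R / (m k)%:R * f (L / (2 * (q k * n k)%:R)).
  by rewrite ler_wpM2l// divr_ge0.
have := le_trans h2 h1.
rewrite -(@ler_pM2l _ (2 / c)) ?divr_gt0// => /(le_trans _); apply.
by rewrite MS natrM le_eqVlt; apply/orP; left; apply/eqP; field; rewrite !gt_eqF.
Qed.

End lacunary_set.

(** * Estimates for the two gauges and choice of the scales *)

Section gauges.
Context {R : realType}.

(** With [y = ln (1 / t) >= 1], one has [y - ln theta <= y * (1 - ln theta) <= y / theta]. Raising
    to the power [p = 1 / (2 + eps) <= 1] costs a factor at most [1 / theta]. *)
Lemma f_eps_ge_scale (eps theta t : R) : 0 < eps -> 0 < theta <= 1 ->
  0 < t <= expR (- 3) -> theta * f_eps eps t <= f_eps eps (theta * t).
Proof.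
move=> eps0 /andP[th0 th1] /andP[t0 t3]; rewrite /f_eps !powRN.
set p := 1 / (2 + eps).
have e2 : 0 < 2 + eps by rewrite addr_gt0.
have p0 : 0 <= p by rewrite divr_ge0// ltW.
have p1 : p <= 1 by rewrite ler_pdivrMr//; lra.
rewrite !div1r !lnV ?posrE ?mulr_gt0// lnM ?posrE//.
have lnt : ln t <= - 3 by rewrite -[leRHS]expRK ler_ln ?posrE ?expR_gt0.
have lnth : ln theta <= 0 by rewrite ln_le0.
have y0 : 0 < - ln t by lra.
have yz0 : 0 < - (ln theta + ln t) by lra.
rewrite -[leRHS]div1r ler_pdivlMr ?powR_gt0// mulrAC ler_pdivrMr ?powR_gt0//.
rewrite mul1r.
have h : - (ln theta + ln t) <= - ln t / theta.
  have := expR_ge1Dx (- ln theta).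
  rewrite expRN lnK ?posrE// -(ler_pM2l y0) => h; apply: le_trans h.
  nra.
rewrite -ler_pdivlMl//.
apply: (le_trans (ge0_ler_powR p0 _ _ h)).
- by rewrite nnegrE ltW.
- by rewrite nnegrE divr_ge0// ltW.
rewrite powRM ?invr_ge0 ?(ltW y0) ?(ltW th0)// mulrC ler_pM2r ?powR_gt0//.
by rewrite ler1_powR// invf_ge1.
Qed.

(** Although [m] occurs inside the exponential, the logarithm of the reciprocal scale is at most
    [m ^ 2 * B] with [B] free of [m]. Once [m] to the power [eps] exceeds [B], this is at most [m]
    to the power [2 + eps]; positivity of [eps] is essential. *)
Lemma exists_branching (eps L A : R) k D : 0 < eps -> 0 < L ->
  L * expR 3 <= A -> (0 < D)%N -> exists m : nat, (1 < m)%N /\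
  m%:R^-1 <= f_eps eps (L / (2 *
    ((Num.truncn (A * expR (k%:R * (m * D)%:R ^+ 2))).+2 * (m * D))%:R)).
Proof.
move=> eps0 L0 LA D0.
have A0 : 0 < A by rewrite (lt_le_trans _ LA)// mulr_gt0 ?expR_gt0.
have Dr : 0 < D%:R :> R by rewrite ltr0n.
(* The first summand comes from the exponent; the second comes from [ln x <= x] applied to the
   remaining factor, using [m <= m ^ 2]. *)
pose B : R := k%:R * D%:R ^+ 2 + 2 * (A + 2) * D%:R / L.
have B0 : 0 < B.
  rewrite ltr_wpDl ?mulr_ge0 ?sqr_ge0// divr_gt0// mulr_gt0// mulr_gt0//.
  by rewrite addr_gt0.
pose m := (Num.truncn (B `^ (1 / eps))).+2.
have m1 : 1 <= m%:R :> R by rewrite ler1n.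
have m0 : 0 < m%:R :> R by rewrite ltr0n.
exists m; split => //; rewrite natrM.
set E := expR _; set q := (Num.truncn (A * E)).+2; set n := (m * D)%N.
have n0 : 1 <= n%:R :> R by rewrite ler1n muln_gt0.
have n0' : 0 < n%:R :> R := lt_le_trans ltr01 n0.
have E1 : 1 <= E by rewrite -expR0 ler_expR mulr_ge0// sqr_ge0.
have AE0 : 0 <= A * E by rewrite mulr_ge0// ?ltW// expR_gt0.
have qA : A * E <= q%:R.
  apply: ltW; apply: lt_le_trans (truncnS_gt _) _. by rewrite /q ler_nat.
have qle : q%:R <= (A + 2) * E.
  have /andP[h _] := truncn_itv AE0.
  rewrite /q -addn2 natrD mulrDl; apply: lerD => //; lra.
have q0 : 0 < q%:R :> R by rewrite ltr0n.
rewrite /f_eps div1r invf_div; set z := _ / L.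
have z0 : 0 < z by rewrite divr_gt0// mulr_gt0// mulr_gt0.
have z1 : 1 < z.
  rewrite /z ltr_pdivlMr// mul1r.
  have : expR 0 < expR 3 :> R by rewrite ltr_expR.
  rewrite expR0 => e3; have : L < A by apply: lt_le_trans LA; rewrite ltr_pMr.
  nra.
have y0 : 0 < ln z by rewrite ln_gt0.
have yB : ln z <= m%:R ^+ 2 * B.
  have : z <= E * (2 * (A + 2) * n%:R / L).
    have -> : E * (2 * (A + 2) * n%:R / L) = 2 * ((A + 2) * E * n%:R) / L by ring.
    by rewrite ler_pM2r ?invr_gt0// ler_pM2l// ler_pM2r.
  have x0 : 0 < 2 * (A + 2) * n%:R / L.
    by rewrite divr_gt0// mulr_gt0// mulr_gt0// addr_gt0.
  have E0 : 0 < E := expR_gt0 _.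
  move=> zE; apply: (@le_trans _ _ (ln (E * (2 * (A + 2) * n%:R / L)))).
    by rewrite ler_ln// posrE mulr_gt0.
  rewrite lnM ?posrE// expRK.
  have := ltW (ln_sublinear x0) => hx.
  rewrite /n natrM in hx *; rewrite exprMn mulrCA /B [leRHS]mulrDr lerD2l.
  apply: (le_trans hx).
  have -> : m%:R ^+ 2 * (2 * (A + 2) * D%:R / L) =
    m%:R * (2 * (A + 2) * (m%:R * D%:R) / L) by ring.
  by rewrite ler_peMl// ltW// -natrM.
have Bm : B <= m%:R `^ eps.
  have h : B `^ (1 / eps) <= m%:R.
    by rewrite ltW// (lt_le_trans (truncnS_gt _))// ler_nat.
  have : (B `^ (1 / eps)) `^ eps <= m%:R `^ eps.
    by apply: ge0_ler_powR h; rewrite ?nnegrE ?powR_ge0// ltW.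
  by rewrite -powRrM mul1r mulVf ?gt_eqF// powRr1// ltW.
have pp : 0 < 1 / (2 + eps) by rewrite divr_gt0// addr_gt0.
rewrite powRN lef_pV2 ?posrE ?powR_gt0//.
have h : ln z <= m%:R `^ (2 + eps).
  rewrite powRD; last by apply/implyP => _; rewrite gt_eqF.
  rewrite powR_mulrn ?(ltW m0)//; apply: (le_trans yB).
  by rewrite ler_wpM2l// sqr_ge0.
have : ln z `^ (1 / (2 + eps)) <= (m%:R `^ (2 + eps)) `^ (1 / (2 + eps)).
  by apply: ge0_ler_powR h; rewrite ?nnegrE ?powR_ge0// ltW.
by rewrite -powRrM mul1r mulfV ?gt_eqF ?addr_gt0// powRr1// ltW.
Qed.

Lemma exists_scales (eps L A : R) : 0 < eps -> 0 < L -> L * expR 3 <= A ->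
  exists n m q : nat -> nat, [/\ n 0%N = 2%N,
    forall k, n k.+1 = (m k * (q k * n k))%N,
    forall k, (1 < m k)%N,
    forall k, q k = (Num.truncn (A * expR (k%:R * (n k)%:R ^+ 2))).+2
  & forall k, (m k)%:R^-1 <= f_eps eps (L / (2 * (q k.+1 * n k.+1)%:R))].
Proof.
move=> eps0 L0 LA.
pose Q k n := (Num.truncn (A * expR (k%:R * n%:R ^+ 2))).+2.
have ex (kD : nat * nat) : exists m, (0 < kD.2)%N -> (1 < m)%N /\
    m%:R^-1 <= f_eps eps (L / (2 * (Q kD.1 (m * kD.2) * (m * kD.2))%:R)).
  have [D0|D0] := posnP kD.2; first by exists 0%N.
  by have [m mP] := exists_branching kD.1 eps0 L0 LA D0; exists m.
have [mf mP] := choice ex.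
(* The branching number of stage [k] is chosen from [D = q k * n k] but with index [k.+1], because
   it must beat the gauge at the next scale. *)
pose n := fix n k := if k is j.+1
  then (mf (j.+1, Q j (n j) * n j) * (Q j (n j) * n j))%N else 2%N.
have n0 k : (0 < n k)%N.
  elim: k => //= k IH.
  by have [|m1 _] := mP (k.+1, Q k (n k) * n k)%N;
    rewrite /= ?muln_gt0 ?IH ?(ltnW m1).
have pos k : (0 < (k.+1, Q k (n k) * n k).2)%N by rewrite /= muln_gt0 n0.
exists n, (fun k => mf (k.+1, Q k (n k) * n k)%N), (fun k => Q k (n k)).
split => // k; first by have [] := mP _ (pos k).
by have [_] := mP _ (pos k).
Qed.

(** At this scale the square root of [ln (1 / t)] is [n] times that of [k], so the number [n] of
    intervals cancels. The iterated-logarithm factor is at most [1] because [k * n ^ 2 >= e]. *)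
Lemma h_alpha_le (alpha : R) k n : 0 < alpha -> (0 < n)%N ->
  expR 1 <= k%:R :> R ->
  n%:R * h_alpha alpha (expR (- (k%:R * n%:R ^+ 2))) <= (Num.sqrt k%:R)^-1.
Proof.
move=> alpha0 n0 ek; rewrite /h_alpha div1r expRN invrK expRK.
have n1 : 1 <= n%:R :> R by rewrite ler1n.
have n0' : 0 < n%:R :> R by rewrite ltr0n.
have k0 : 0 < k%:R :> R by rewrite (lt_le_trans (expR_gt0 1)).
have ln1 : 1 <= ln (k%:R * n%:R ^+ 2) :> R.
  rewrite -[leLHS]expRK ler_ln ?posrE ?expR_gt0 ?mulr_gt0 ?exprn_gt0//.
  by apply: (le_trans ek); rewrite ler_peMr ?(ltW k0)// exprn_ege1.
rewrite !powRN div1r powR12_sqrt ?mulr_ge0 ?sqr_ge0//.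
rewrite sqrtrM// sqrtr_sqr ger0_norm// invfM.
have ln2 : 1 <= ln (k%:R * n%:R ^+ 2) `^ alpha :> R.
  by rewrite -[leLHS](powRr0 (ln (k%:R * n%:R ^+ 2)));
    apply: ler_powR => //; exact: ltW.
set p := _ `^ _ in ln2 *; have p0 : 0 < p by rewrite (lt_le_trans ltr01).
have s0 : 0 < Num.sqrt k%:R :> R by rewrite sqrtr_gt0.
have -> : n%:R * ((Num.sqrt k%:R)^-1 / n%:R / p) = (Num.sqrt k%:R)^-1 / p.
  by field; rewrite !gt_eqF.
by rewrite ler_piMr ?invr_ge0 ?(ltW s0)// invf_le1.
Qed.

End gauges.

(** * Assembly: observability, positive finite content, null content *)

Theorem proposition4p8 (R : realType) (L : R) (hL : 0 < L)
  (f : R -> R -> R)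
  (hf : forall eps : R, 0 < eps -> gauge_extension (f_eps eps) (f eps))
  (h : R -> R -> R)
  (hh : forall alpha : R, 0 < alpha ->
          gauge_extension (h_alpha alpha) (h alpha))
  (eps : R) (heps : 0 < eps) :
  exists Einf : set R,
    [/\ Einf `<=` `]0, L[,
        forall T : R, 0 < T -> ~ observable L T Einf,
        (0 < hausdorff_content (f eps) Einf < +oo)%E
      & forall alpha : R, 0 < alpha ->
          hausdorff_content (h alpha) Einf = 0%E].
Proof.
have [gf fE _] := hf eps heps.
have e3 : 1 <= expR 3 :> R by rewrite -expR0 ler_expR.
(* The term [L * expR 3] puts the scales below [exp (- 3)], where the gauge formula is valid;
   [4 * L] absorbs the diameters of the covering balls used for [h_alpha]. *)
pose A := 1 + 4 * L + L * expR 3.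
have LA : L * expR 3 <= A by rewrite /A lerDr; lra.
have A1 : 1 <= A by rewrite /A -addrA lerDl; nra.
have A4 : 4 * L <= A by rewrite /A; nra.
have [n [m [q [n0 nS m2 qE mf]]]] := exists_scales heps hL LA.
have q2 k : (1 < q k)%N by rewrite qE.
have n_gt0 k : (0 < n k)%N.
  elim: k => [|k IH]; first by rewrite n0.
  by rewrite nS !muln_gt0 IH (ltnW (m2 k)) (ltnW (q2 k)).
have nr0 k : 0 < (n k)%:R :> R by rewrite ltr0n.
have nr1 k : 1 <= (n k)%:R :> R by rewrite ler1n.
have D0 k : 0 < (q k * n k)%:R :> R by rewrite ltr0n muln_gt0 n_gt0 ltnW.
have D_ge k : A * expR (k%:R * (n k)%:R ^+ 2) <= (q k * n k)%:R.
  apply: (@le_trans _ _ (q k)%:R); last by rewrite ler_nat leq_pmulr.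
  by rewrite qE ltW// (lt_le_trans (truncnS_gt _))// ler_nat.
have exp1 k : 1 <= expR (k%:R * (n k)%:R ^+ 2).
  by rewrite -expR0 ler_expR mulr_ge0// sqr_ge0.
have D_geA k : A <= (q k * n k)%:R.
  by apply: le_trans (D_ge k); rewrite ler_peMr// (le_trans ler01).
have small k : L / (2 * (q k * n k)%:R) <= expR (- 3).
  rewrite expRN ler_pdivrMr ?mulr_gt0// mulrC ler_pdivlMr ?expR_gt0//.
  by apply: (le_trans LA); apply: (le_trans (D_geA k)); rewrite ler_peMl ?ltW//; lra.
pose E := lacunary_set L n q.
have feps0 t : 0 < t -> t <= expR (- 3) -> 0 < f_eps eps t.
  move=> t0 t3; rewrite /f_eps powR_gt0// ln_gt0// div1r invf_gt1//.
  by rewrite (le_lt_trans t3)// expR_lt1 oppr_lt0.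
have size0 k : 0 < L / (2 * (q k * n k)%:R) by rewrite divr_gt0// mulr_gt0.
have fE0 : (0 < hausdorff_content (f eps) E)%E.
  (* The second entry handles stage [0], where [M 0 = 1]; at later stages [c <= 1] suffices. *)
  pose c := Order.min 1 (f_eps eps (L / (2 * (q 0 * n 0)%:R))).
  apply: (@content_lacunary_gt0 _ L n m q hL n0 nS m2 q2 _ (expR (- 3)) c) => //.
  - by rewrite /c lt_min ltr01 feps0.
  - move=> theta t th t3; have /andP[t0 t3'] := t3; have /andP[th0 th1] := th.
    rewrite !fE//; [exact: f_eps_ge_scale| |]; first by rewrite mulr_gt0.
    by apply: le_trans t3'; rewrite ler_piMl// ltW.
  - case=> [|k]; rewrite fE//.
      by rewrite big_ord0 divr1 ge_min lexx orbT.
    apply: le_trans (mf k).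
    have mk : 0 < (m k)%:R :> R by rewrite ltr0n ltnW.
    rewrite big_ord_recr/= natrM invfM mulrA ler_piMl ?invr_ge0 ?(ltW mk)//.
    have M1 : 1 <= (\prod_(i < k) m i)%N%:R :> R.
      by rewrite ler1n prodn_gt0// => i; rewrite ltnW.
    rewrite ler_pdivrMr ?(lt_le_trans ltr01)// mul1r (le_trans _ M1)//.
    by rewrite ge_min lexx.
exists E; split => //.
- by move=> x [+ _]; rewrite /= in_itv.
- move=> T T0; apply: not_observable => //.
    by exists (param L n m q 0); exact: param_lacunary.
  move=> K K0; have pi0 := pi_gt0 R.
  pose c := (pi / L) ^+ 2 * T.
  have c0 : 0 <= c by rewrite mulr_ge0 ?sqr_ge0// ltW.
  (* With [k > c + K * pi], [exp ((k - c) * n ^ 2)] is at least [1 + K * pi * n ^ 2], which exceeds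
     the required product. *)
  pose k := (Num.truncn (c + K * pi)).+1.
  have kc : c + K * pi < k%:R := truncnS_gt _.
  exists (n k), ((n k)%:R * pi / (q k * n k)%:R); split => //.
    move=> x [/andP[x0 xL] /(_ k)[i /andP[ix xi]]].
    have -> : (n k)%:R * pi / L * x = i%:R * pi +
        (n k)%:R * pi / L * (x - i%:R * L / (n k)%:R).
      by move: (pi : R) => p; field; rewrite !gt_eqF.
    rewrite norm_sin_natpiD; apply: (le_trans (norm_sin_le _)).
    have s0 : 0 < (n k)%:R * pi / L by rewrite divr_gt0// mulr_gt0.
    rewrite ger0_norm; last by rewrite mulr_ge0 ?subr_ge0// ltW.
    have -> : (n k)%:R * pi / (q k * n k)%:R =
      (n k)%:R * pi / L * (L / (q k * n k)%:R).
      move: (pi : R) => p; field.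
      by rewrite !gt_eqF// ltr0n ltnW.
    by rewrite ler_pM2l// lerBlDl.
  rewrite mulrA ltr_pdivrMr//.
  apply: (@lt_le_trans _ _ (expR (- ((n k)%:R ^+ 2 * c)) *
    expR (k%:R * (n k)%:R ^+ 2))); last first.
    have -> : ((n k)%:R * pi / L) ^+ 2 * T = (n k)%:R ^+ 2 * c.
      by rewrite /c; move: (pi : R) => p; field; rewrite gt_eqF.
    rewrite ler_pM2l ?expR_gt0//; apply: le_trans (D_ge k).
    by rewrite ler_peMl// expR_ge0.
  rewrite -expRD.
  apply: (@lt_le_trans _ _ (1 + (K * pi) * (n k)%:R ^+ 2)).
    rewrite (_ : K * (n k)%:R * ((n k)%:R * pi) = K * pi * (n k)%:R ^+ 2).
      by rewrite ltrDr.
    by move: (pi : R) => p; ring.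
  apply: le_trans (expR_ge1Dx _); rewrite lerD2l.
  have n20 : 0 < (n k)%:R ^+ 2 :> R by rewrite exprn_gt0.
  by move: (n k)%:R (pi : R) kc n20 => N p kc n20; nra.
- rewrite fE0/=; apply: (@le_lt_trans _ _ (1%:R * f eps (2 * L))%:E);
    last exact: ltry.
  apply: (@content_le_finite_cover _ _ _ 1 (fun=> 0)) => // x [/andP[x0 xL] _].
  by exists 0%N => //; rewrite /ball/= sub0r normrN ger0_norm// ltW.
move=> alpha alpha0; have [gh hE _] := hh alpha alpha0.
have [h0 h1 _ _] := gh.
apply/eqP; rewrite eq_le; apply/andP; split; last first.
  apply: le_ereal_inf_tmp => _ [c [r [r0 _ ->]]].
  by apply: nneseries_ge0 => j _ _; rewrite lee_fin h0// mulr_gt0.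
apply/lee_addgt0Pr => e e0; rewrite add0e.
(* The summands serve respectively [h_alpha_le], the bound of [k ^ (- 1 / 2)] by [e], and a scale
   below [exp (- 3)]. *)
pose k := (Num.truncn (expR 1 + e ^- 2 + 3)).+1.
have kgt : expR 1 + e ^- 2 + 3 < k%:R := truncnS_gt _.
have ee0 : 0 < e ^- 2 by rewrite invr_gt0 exprn_gt0.
have ex1 := expR_gt0 (1 : R).
(* Twice the interval length, so that the open ball about a left endpoint contains the closed
   interval. *)
pose r := 2 * L / (q k * n k)%:R.
have r0 : 0 < r by rewrite divr_gt0// mulr_gt0.
apply: (@le_trans _ _ ((n k)%:R * h alpha (2 * r))%:E).
  apply: (@content_le_finite_cover _ _ _ (n k) (fun i => i%:R * L / (n k)%:R)) => //.
  move=> x [/andP[x0 xL] /(_ k)[i /andP[ix xi]]]; exists i.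
    rewrite -(ltr_nat R) -(ltr_pM2r hL) -[ltRHS]mulrC -ltr_pdivrMr//.
    exact: le_lt_trans ix xL.
  rewrite /ball/= distrC ger0_norm ?subr_ge0// ltrBlDl (le_lt_trans xi)//.
  rewrite ltrD2l /r -mulrA ltr_pMl ?divr_gt0//; lra.
rewrite lee_fin.
have rle : 2 * r <= expR (- (k%:R * (n k)%:R ^+ 2)).
  rewrite expRN /r mulrA ler_pdivrMr// [leRHS]mulrC ler_pdivlMr ?expR_gt0//.
  apply: le_trans (D_ge k); rewrite ler_pM2r ?expR_gt0//; lra.
have rh : h alpha (2 * r) <= h alpha (expR (- (k%:R * (n k)%:R ^+ 2))).
  move: rle; rewrite le_eqVlt => /orP[/eqP->//|rlt].
  by rewrite ltW// h1// mulr_gt0.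
have n21 : 1 <= (n k)%:R ^+ 2 :> R by rewrite exprn_ege1.
rewrite (hE (expR _)) ?expR_gt0// in rh; last by rewrite ler_expR lerN2; nra.
apply: (@le_trans _ _ ((n k)%:R *
  h_alpha alpha (expR (- (k%:R * (n k)%:R ^+ 2))))); first by rewrite ler_pM2l.
have ek : expR 1 <= k%:R :> R by move: (e ^- 2) ee0 kgt => y; lra.
apply: (le_trans (h_alpha_le alpha0 (n_gt0 k) ek)).
rewrite invf_ple ?posrE ?sqrtr_gt0 ?ltr0n//.
rewrite -[leLHS]ger0_norm ?invr_ge0 ?(ltW e0)// -sqrtr_sqr ler_wsqrtr// exprVn.
by move: (e ^- 2) (k%:R : R) ee0 kgt => x y; lra.
Qed.
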